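(* Let $G$ be a spanning subgraph of a graph $\widetilde G$ (i.e. $V(G)=V(\widetilde G)$ and $E(G)\subseteq E(\widetilde G)$). Suppose $A\in\mathcal{S}_L(G)$ has the SSPWL. Then for every $\delta>0$ there is a matrix $A'\in\mathcal{S}_L(\widetilde G)$ such that (1) $\operatorname{spec}(A')=\operatorname{spec}(A)$, (2) $A'$ has the SSPWL, and (3) $\|A'-A\|<\delta$.
   Context: Graphs are finite and simple. For a graph $G$ on vertex set $\{1,\ldots,n\}$, $\mathcal{S}_L(G)$ denotes the set of weighted Laplacian matrices of $G$: all $n\times n$ real symmetric matrices $A=[a_{i,j}]$ with, for $i\ne j$, $a_{i,j}<0$ if $\{i,j\}\in E(G)$ and $a_{i,j}=0$ if $\{i,j\}\notin E(G)$, and with $a_{i,i}=-\sum_{k:\{k,i\}\in E(G)}a_{i,k}$ for all $i$ (so all row sums are zero). Let $J$ be the $n\times n$ all-ones matrix and $H=I-\frac1n J$. A matrix $A\in\mathcal{S}_L(G)$ has the strong spectral property for weighted Laplacian matrices (SSPWL) if $X=O$ is the only real symmetric $n\times n$ matrix satisfying $A\circ X=I\circ X=O$ and $H(AX-XA)H=O$, where $\circ$ is the entrywise product. $\operatorname{spec}$ denotes the multiset of eigenvalues; $\|\cdot\|$ is the norm induced by the inner product $\langle A,B\rangle=\operatorname{tr}(B^\top A)$. *)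

(* Defs.v *)
From mathcomp Require Import all_boot all_order all_algebra.
From mathcomp Require Import reals.

Set Implicit Arguments.
Unset Strict Implicit.
Unset Printing Implicit Defensive.

Import Order.TTheory GRing.Theory Num.Theory.

Local Open Scope ring_scope.

(* The vertex set {1, ..., n} is represented by 'I_n = {0, ..., n - 1}. *)
Record sgraph (n : nat) : Type := SGraph {
  adj :> rel 'I_n;
  adj_sym : symmetric adj;
  adj_irrefl : irreflexive adj
}.

(* Both graphs live on 'I_n, so only the edge sets have to be compared. *)
Definition spanning_subgraph (n : nat) (G H : sgraph n) : Prop :=
  subrel (adj G) (adj H).

Section Matrices.

Variables (R : realType) (n : nat).
Implicit Types (A B X : 'M[R]_n) (G : sgraph n).

Definition symmetric_mx A : Prop := A^T = A.

Definition weighted_laplacian G A : Prop :=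
  [/\ symmetric_mx A,
      forall i j : 'I_n, i != j -> G i j -> A i j < 0,
      forall i j : 'I_n, i != j -> ~~ G i j -> A i j = 0
    & forall i : 'I_n, A i i = - \sum_(k < n | G k i) A i k].

Definition hadamard A B : 'M[R]_n := map2_mx *%R A B.

Definition centering_mx : 'M[R]_n := 1%:M - n%:R^-1 *: const_mx 1.

Definition SSPWL A : Prop :=
  forall X : 'M[R]_n,
    symmetric_mx X ->
    hadamard A X = 0 ->
    hadamard 1%:M X = 0 ->
    centering_mx *m (A *m X - X *m A) *m centering_mx = 0 ->
    X = 0.

(* The multiset of eigenvalues, as the function sending each real number to
   its algebraic multiplicity (0 if it is not an eigenvalue). Only real
   eigenvalues are recorded; a real symmetric matrix has no others. *)
Definition spec A : R -> nat := fun a => mup a (char_poly A).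

Definition mx_inner A B : R := \tr (B^T *m A).

Definition frobenius_norm A : R := Num.sqrt (mx_inner A A).

End Matrices.

Lemma spec_gt0 (R : realType) (n : nat) (A : 'M[R]_n) (a : R) :
  (0 < spec A a)%N = eigenvalue A a.
Proof.
rewrite /spec -XsubC_dvd ?monic_neq0 ?char_poly_monic //.
by rewrite dvdp_XsubCl eigenvalue_root_char.
Qed.

(* Main.v *)
Require Import Defs.
From mathcomp Require Import all_boot all_order all_algebra.
From mathcomp Require Import reals.
From mathcomp Require Import boolp classical_sets topology normedtype.
From mathcomp Require Import derive realfun.
From mathcomp Require Import ring lra.

(** The matrix [A'] is found as the solution of a minimisation problem, so that
no implicit function theorem is needed.

Let [N] be the set of non-adjacent pairs of distinct vertices of [G], let [J]
be the all-ones matrix and let [T] be a small symmetric matrix supported on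
[N], with a small negative entry at each edge of the larger graph that is not
an edge of [G], and zero elsewhere. Every [Q^T A Q] with [Q] orthogonal and
[Q J = J] is symmetric, has the spectrum of [A] and has zero row sums. It
therefore suffices to find such a [Q], with [Q^T A Q] close to [A], for which
the entries of [Q^T A Q] on [N] are those of [T]: closeness takes care of the
entries at the edges of [G], which stay negative.

Write [P] for the restriction of a matrix to the positions in [N]. The set of
admissible [Q] is compact, so the continuous function
  [g Q = ||P (Q^T A Q) - T|| + c ||Q^T A Q - A||]
has a minimiser for every [c > 0]. Put [B = Q^T A Q] and [X = P B - T] for it.
Comparing with [Q = I] gives [c ||B - A|| <= ||T||], hence [B] is as close to
[A] as desired when [T] is small. If [X] were not zero, one could follow the
curve of conjugates of [B] by Cayley transforms of multiples of the skew matrix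
[K = H (B X - X B) H]. It kills the all-ones vector, and since
[<X, B K - K B> = ||K||^2], the first term of [g] decreases at a rate
proportional to [||K||^2 / ||X||] ([isospectral_descent]), whereas the second
one grows at a rate at most proportional to [c ||A|| ||K||]
([Cayley_perturbation]). The SSPWL says precisely that [X |-> H (A X - X A) H]
is injective on the symmetric matrices supported on [N]. By compactness of the
unit sphere it is then bounded below there by some [sigma > 0], and this
persists for matrices near [A] ([compressed_commutator_bounded_below_near]). So
[||K|| >= sigma ||X||], the decrease wins as soon as [c] is small compared to
[sigma / ||A||], and minimality forces [X = 0]
([isospectral_prescribed_entries]). The same lower bound shows that the SSPWL
is inherited by [A']. *)

Set Implicit Arguments.
Unset Strict Implicit.
Unset Printing Implicit Defensive.

Import Order.TTheory GRing.Theory Num.Theory.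
Import numFieldNormedType.Exports.

Local Open Scope ring_scope.

(** * The Frobenius norm *)

Section FrobeniusNorm.
Variables (R : realType) (n : nat).
Implicit Types X Y Z U : 'M[R]_n.

(** With [a], [b], [c] the three sums, [\sum_i (c f_i - b g_i)^2] equals
[c (a c - b^2)]; if [c = 0] then every [g_i] is zero. *)
Lemma sum_Cauchy_Schwarz (I : finType) (f g : I -> R) :
  (\sum_i f i * g i) ^+ 2 <= (\sum_i f i ^+ 2) * (\sum_i g i ^+ 2).
Proof.
set a := \sum_i f i ^+ 2; set b := \sum_i f i * g i; set c := \sum_i g i ^+ 2.
have c0 : 0 <= c by apply: sumr_ge0 => i _; exact: sqr_ge0.
have key : 0 <= c * (a * c - b ^+ 2).
  have -> : c * (a * c - b ^+ 2) = \sum_i (c * f i - b * g i) ^+ 2.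
    rewrite (eq_bigr (fun i => c ^+ 2 * f i ^+ 2 + (- (2 * c * b)) * (f i * g i)
      + b ^+ 2 * g i ^+ 2)) => [|i _]; last by ring.
    by rewrite !big_split -!mulr_sumr /= -/a -/b -/c; ring.
  by apply: sumr_ge0 => i _; exact: sqr_ge0.
have [cp|] := ltP 0 c; first by rewrite -subr_ge0 -(pmulr_rge0 _ cp).
move=> c_le0; have {c_le0} cz : c = 0 by apply/eqP; rewrite eq_le c_le0.
have gz i : g i = 0.
  have /eqP := cz; rewrite psumr_eq0 => [/allP/(_ i)|j _]; last exact: sqr_ge0.
  by rewrite mem_index_enum sqrf_eq0 => /(_ isT)/eqP.
by rewrite cz mulr0 /b big1 ?expr0n // => i _; rewrite gz mulr0.
Qed.

Lemma mx_innerE X Y : mx_inner X Y = \sum_i \sum_j X i j * Y i j.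
Proof.
rewrite /mx_inner /mxtrace exchange_big /=; apply: eq_bigr => j _.
by rewrite !mxE; apply: eq_bigr => i _; rewrite !mxE mulrC.
Qed.

Lemma mx_innerC X Y : mx_inner X Y = mx_inner Y X.
Proof.
by rewrite !mx_innerE; apply: eq_bigr => i _; apply: eq_bigr => j _; rewrite mulrC.
Qed.

Lemma mx_innerDl X Y Z : mx_inner (X + Y) Z = mx_inner X Z + mx_inner Y Z.
Proof. by rewrite /mx_inner mulmxDr mxtraceD. Qed.

Lemma mx_innerZl c X Z : mx_inner (c *: X) Z = c * mx_inner X Z.
Proof. by rewrite /mx_inner -scalemxAr mxtraceZ. Qed.

Lemma mx_innerDr X Y Z : mx_inner Z (X + Y) = mx_inner Z X + mx_inner Z Y.
Proof. by rewrite mx_innerC mx_innerDl !(mx_innerC Z). Qed.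

Lemma mx_innerZr c X Z : mx_inner Z (c *: X) = c * mx_inner Z X.
Proof. by rewrite mx_innerC mx_innerZl mx_innerC. Qed.

Lemma mx_inner_ge0 X : 0 <= mx_inner X X.
Proof.
by rewrite mx_innerE; do 2!apply: sumr_ge0 => ? _; rewrite -expr2 sqr_ge0.
Qed.

Lemma frobenius_sqr X : frobenius_norm X ^+ 2 = mx_inner X X.
Proof. by rewrite sqr_sqrtr // mx_inner_ge0. Qed.

Lemma frobenius_ge0 X : 0 <= frobenius_norm X.
Proof. exact: sqrtr_ge0. Qed.

Lemma frobenius_sqrE X : frobenius_norm X ^+ 2 = \sum_i \sum_j X i j ^+ 2.
Proof. by rewrite frobenius_sqr mx_innerE. Qed.

Lemma ler_entry_frobenius X i j : `|X i j| <= frobenius_norm X.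
Proof.
rewrite -ler_sqr ?nnegrE ?frobenius_ge0 // frobenius_sqrE real_normK ?num_real //.
rewrite (bigD1 i) //= (bigD1 j) //= -addrA lerDl.
by rewrite addr_ge0 //; repeat (apply: sumr_ge0 => ? _); rewrite sqr_ge0.
Qed.

Lemma frobenius_eq0 X : frobenius_norm X = 0 -> X = 0.
Proof.
move=> X0; apply/matrixP=> i j; rewrite mxE; apply/eqP.
by rewrite -normr_le0 -X0 ler_entry_frobenius.
Qed.

Lemma frobenius0 : frobenius_norm (0 : 'M[R]_n) = 0.
Proof. by rewrite /frobenius_norm /mx_inner mulmx0 mxtrace0 sqrtr0. Qed.

Lemma frobeniusZ c X : frobenius_norm (c *: X) = `|c| * frobenius_norm X.
Proof.
rewrite /frobenius_norm mx_innerZl mx_innerZr mulrA -expr2 sqrtrM ?sqr_ge0 //.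
by rewrite sqrtr_sqr.
Qed.

Lemma frobeniusN X : frobenius_norm (- X) = frobenius_norm X.
Proof. by rewrite -scaleN1r frobeniusZ normrN1 mul1r. Qed.

Lemma mx_inner_Cauchy_Schwarz X Y :
  mx_inner X Y <= frobenius_norm X * frobenius_norm Y.
Proof.
apply: (le_trans (ler_norm _)).
rewrite -ler_sqr ?nnegrE ?mulr_ge0 ?frobenius_ge0 // exprMn !frobenius_sqrE.
rewrite real_normK ?num_real // mx_innerE !pair_bigA.
exact: sum_Cauchy_Schwarz.
Qed.

Lemma frobeniusD X Y :
  frobenius_norm (X + Y) <= frobenius_norm X + frobenius_norm Y.
Proof.
rewrite -ler_sqr ?nnegrE ?addr_ge0 ?frobenius_ge0 // sqrrD !frobenius_sqr.
rewrite mx_innerDl !mx_innerDr (mx_innerC Y X).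
by have := mx_inner_Cauchy_Schwarz X Y; lra.
Qed.

Lemma frobeniusB X Y :
  frobenius_norm (X - Y) <= frobenius_norm X + frobenius_norm Y.
Proof. by rewrite -(frobeniusN Y) frobeniusD. Qed.

Lemma frobeniusM X Y :
  frobenius_norm (X *m Y) <= frobenius_norm X * frobenius_norm Y.
Proof.
rewrite -ler_sqr ?nnegrE ?mulr_ge0 ?frobenius_ge0 // exprMn !frobenius_sqrE.
rewrite [X in _ <= _ * X]exchange_big mulr_suml; apply: ler_sum => i _.
rewrite mulr_sumr; apply: ler_sum => j _.
by rewrite mxE sum_Cauchy_Schwarz.
Qed.

Lemma frobenius_commutator X Y :
  frobenius_norm (X *m Y - Y *m X) <= 2 * (frobenius_norm X * frobenius_norm Y).
Proof.
apply: (le_trans (frobeniusB _ _)).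
have := frobeniusM X Y; have := frobeniusM Y X.
by rewrite (mulrC (frobenius_norm Y)); lra.
Qed.

Lemma frobenius_orth_conj U X : U^T *m U = 1%:M ->
  frobenius_norm (U^T *m X *m U) = frobenius_norm X.
Proof.
move=> UU; have UU' := mulmx1C UU.
rewrite /frobenius_norm /mx_inner !trmx_mul trmxK !mulmxA mxtrace_mulC !mulmxA.
by rewrite UU' mul1mx -!mulmxA (mulmxA U) UU' mul1mx.
Qed.

End FrobeniusNorm.

(** * Conjugation by orthogonal matrices *)

Section OrthogonalConjugation.
Variables (R : realType) (n : nat).
Local Notation J := (const_mx 1 : 'M[R]_n).

Lemma char_poly_orth_conj (U A : 'M[R]_n) : U^T *m U = 1%:M ->
  char_poly (U^T *m A *m U) = char_poly A.
Proof.
move=> UU; rewrite /char_poly.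
have -> : char_poly_mx (U^T *m A *m U) =
    map_mx polyC U^T *m char_poly_mx A *m map_mx polyC U.
  rewrite /char_poly_mx mulmxBr mulmxBl -!map_mxM; congr (_ - _).
  by rewrite mul_mx_scalar -scalemxAl -map_mxM UU map_mx1 scalemx1.
rewrite !det_mulmx mulrAC -det_mulmx -map_mxM UU map_mx1 det1.
by rewrite mul1r.
Qed.

(** If [v (I + K) = 0], multiplying by [v^T] gives [v v^T = 0], because the
scalar [v K v^T] is its own transpose and hence its own opposite. *)
Lemma skew_add1_unitmx (K : 'M[R]_n) : K^T = - K -> 1%:M + K \in unitmx.
Proof.
move=> Ks; rewrite -row_free_unit; apply: inj_row_free => v.
rewrite mulmxDr mulmx1 => /(congr1 (mulmx^~ v^T)).
rewrite mulmxDl mul0mx.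
have vKv0 : v *m K *m v^T = 0.
  have h : v *m K *m v^T = - (v *m K *m v^T).
    rewrite -{1}[LHS]trmxK [(v *m K *m v^T)^T]mx11_scalar tr_scalar_mx -mx11_scalar.
    by rewrite !trmx_mul trmxK Ks mulNmx mulmxN mulmxA.
  apply/matrixP=> i j; have /matrixP/(_ i j) := h; rewrite !mxE.
  by move=> e; lra.
rewrite vKv0 addr0 => /matrixP/(_ 0 0); rewrite !mxE => /eqP.
rewrite psumr_eq0 => [/allP h|j _]; last by rewrite mxE -expr2 sqr_ge0.
apply/rowP=> j; have := h j; rewrite mem_index_enum !mxE -expr2 sqrf_eq0.
by move=> /(_ isT)/eqP.
Qed.

(** The matrix is [U = (I - K) (I + K)^-1]. The difference [D = U^T A U - A] then
satisfies [(I - K) D (I + K) = - 2 (A K - K A)], that is,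
[D + 2 (A K - K A) = K D - D K + K D K], whose right-hand side has norm at most
[3 ||K|| ||D||] because [||K|| <= 1]. The crude bound [||D|| <= 2 ||A||], valid because conjugation
preserves the norm, thus improves to a bound linear in [||K||], and the latter
gives the quadratic bound on the error. *)
Lemma Cayley_perturbation (A K : 'M[R]_n) :
  A^T = A -> K^T = - K -> K *m J = 0 ->
  frobenius_norm K <= 1 ->
  exists U : 'M[R]_n,
    [/\ U^T *m U = 1%:M,
        U *m J = J,
        frobenius_norm (U^T *m A *m U - A) <=
          10 * (frobenius_norm A * frobenius_norm K)
      & frobenius_norm (U^T *m A *m U - A + 2 *: (A *m K - K *m A)) <=
          30 * (frobenius_norm A * frobenius_norm K ^+ 2)].
Proof.
move=> As Ks K1 kle1.
have uP : 1%:M + K \in unitmx by exact: skew_add1_unitmx.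
have uM : 1%:M - K \in unitmx by rewrite skew_add1_unitmx // linearN /= Ks.
set U := (1%:M - K) *m invmx (1%:M + K).
have UT : U^T = invmx (1%:M - K) *m (1%:M + K).
  by rewrite /U trmx_mul trmx_inv !linearD /= linearN /= trmx1 Ks opprK.
have comm : (1%:M + K) *m (1%:M - K) = (1%:M - K) *m (1%:M + K).
  rewrite !(mulmxDl, mulmxDr, mulmxN, mulNmx, mulmx1, mul1mx).
  by apply/matrixP=> i j; rewrite !mxE; ring.
have UU : U^T *m U = 1%:M.
  by rewrite UT /U mulmxA -(mulmxA (invmx _)) comm mulmxA mulVmx // mul1mx mulmxV.
have U1 : U *m J = J.
  have e : (1%:M + K) *m J = J.
    by rewrite mulmxDl K1 addr0 mul1mx.
  rewrite /U -mulmxA -{1}e (mulmxA (invmx _)) mulVmx // mul1mx.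
  by rewrite mulmxBl K1 subr0 mul1mx.
exists U; set B := U^T *m A *m U; set D := B - A.
set a := frobenius_norm A; set k := frobenius_norm K.
have a0 : 0 <= a by exact: frobenius_ge0.
have k0 : 0 <= k by exact: frobenius_ge0.
have D2a : frobenius_norm D <= 2 * a.
  by apply: (le_trans (frobeniusB _ _)); rewrite frobenius_orth_conj // -/a; lra.
have BE : (1%:M - K) *m B *m (1%:M + K) = (1%:M + K) *m A *m (1%:M - K).
  by rewrite /B UT /U !mulmxA mulmxV // mul1mx -!mulmxA mulVmx // mulmx1.
have DE : D + 2 *: (A *m K - K *m A) = (K *m D - D *m K) + K *m D *m K.
  have h : (1%:M - K) *m D *m (1%:M + K) =
      (1%:M + K) *m A *m (1%:M - K) - (1%:M - K) *m A *m (1%:M + K).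
    by rewrite /D mulmxBr mulmxBl BE.
  move: h; rewrite !(mulmxDl, mulmxDr, mulmxN, mulNmx, mulmx1, mul1mx).
  move=> /matrixP h; apply/matrixP=> i j; move: (h i j).
  by rewrite !mxE /=; lra.
have bound x : frobenius_norm D <= x ->
    frobenius_norm (D + 2 *: (A *m K - K *m A)) <= 3 * (k * x).
  move=> Dx; rewrite DE; apply: (le_trans (frobeniusD _ _)).
  have h1 := frobenius_commutator K D.
  have h2 : frobenius_norm (K *m D *m K) <= k * frobenius_norm D.
    apply: (le_trans (frobeniusM _ _)); rewrite -[leRHS]mulr1.
    by apply: ler_pM; rewrite ?frobenius_ge0 ?frobeniusM.
  have h3 : k * frobenius_norm D <= k * x by rewrite ler_wpM2l.
  by rewrite -/k in h1; lra.
have D10 : frobenius_norm D <= 10 * (a * k).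
  have -> : D = (D + 2 *: (A *m K - K *m A)) - 2 *: (A *m K - K *m A).
    by rewrite addrK.
  apply: (le_trans (frobeniusB _ _)); rewrite frobeniusZ gtr0_norm //.
  have := bound _ D2a; have := frobenius_commutator A K.
  by rewrite -/a -/k (mulrCA k); lra.
split=> //; apply: (le_trans (bound _ D10)).
by rewrite le_eqVlt; apply/orP; left; apply/eqP; ring.
Qed.

End OrthogonalConjugation.

(** * Minimisation over closed bounded sets of matrices *)

Section Compactness.
Local Open Scope classical_set_scope.
Variables (R : realType) (n : nat).
Implicit Types (S : set 'M[R]_n) (F : 'M[R]_n -> 'M[R]_n).

Lemma vec_mx_continuous : continuous (@vec_mx R n n).
Proof.
move=> v s /= /(nbhs_ballP (vec_mx v)) [e e0 es].
apply/nbhs_ballP; exists e => //= w [_ vw]; apply: es; split=> // i j.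
by rewrite !mxE; exact: vw.
Qed.

(** Continuity of a matrix-valued map, tested on its entries: in this form it
passes to sums and products as for real-valued functions. *)
Definition entrywise_continuous F := forall i j, continuous (fun Q => F Q i j).

Lemma entrywise_continuous_cst C : entrywise_continuous (fun=> C).
Proof. by move=> i j; exact: cst_continuous. Qed.

Lemma entrywise_continuous_id : entrywise_continuous id.
Proof. by move=> i j; exact: coord_continuous. Qed.

Lemma entrywise_continuous_tr F :
  entrywise_continuous F -> entrywise_continuous (fun Q => (F Q)^T).
Proof.
move=> cF i j; rewrite (_ : (fun Q => _) = (fun Q => F Q j i)) //.
by apply/funext=> Q; rewrite mxE.
Qed.

Lemma entrywise_continuousB F F' :
  entrywise_continuous F -> entrywise_continuous F' ->
  entrywise_continuous (fun Q => F Q - F' Q).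
Proof.
move=> cF cF' i j; rewrite (_ : (fun Q => _) = (fun Q => F Q i j - F' Q i j)).
  by move=> Q; apply: continuousB; [exact: cF|exact: cF'].
by apply/funext=> Q; rewrite !mxE.
Qed.

Lemma entrywise_continuousM F F' :
  entrywise_continuous F -> entrywise_continuous F' ->
  entrywise_continuous (fun Q => F Q *m F' Q).
Proof.
move=> cF cF' i j.
rewrite (_ : (fun Q => _) = (fun Q => \sum_k F Q i k * F' Q k j)).
  apply: continuous_big => [|k _]; first exact: add_continuous.
  by move=> Q; apply: continuousM; [exact: cF|exact: cF'].
by apply/funext=> Q; rewrite !mxE.
Qed.

Lemma continuous_frobenius F :
  entrywise_continuous F -> continuous (fun Q => frobenius_norm (F Q)).
Proof.
move=> cF.
rewrite (_ : (fun Q => _) =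
  Num.sqrt \o (fun Q => \sum_i \sum_j F Q i j * F Q i j)); last first.
  by apply/funext=> Q; rewrite /frobenius_norm mx_innerE.
move=> Q; apply: continuous_comp; last exact: sqrt_continuous.
apply: continuous_big => [|i _]; first exact: add_continuous.
apply: continuous_big => [|j _]; first exact: add_continuous.
by move=> Q'; apply: continuousM; exact: cF.
Qed.

(** It is the zero set of the continuous function [||F Q - F' Q||]. *)
Lemma closed_mx_eq F F' :
  entrywise_continuous F -> entrywise_continuous F' ->
  closed [set Q | F Q = F' Q].
Proof.
move=> cF cF'.
rewrite (_ : mkset _ = (fun Q => frobenius_norm (F Q - F' Q)) @^-1` [set 0]).
  apply: preimage_closed; last exact: closed_eq.
  by move=> Q _; exact/continuous_frobenius/entrywise_continuousB.
apply/seteqP; split=> Q /=; first by move=> ->; rewrite subrr frobenius0.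
by move=> /frobenius_eq0/eqP; rewrite subr_eq0 => /eqP.
Qed.

(** Closed bounded sets of row vectors are compact, and [vec_mx] carries this
over to matrices. *)
Lemma closed_bounded_argmin S (f : 'M[R]_n -> R) M :
  S !=set0 -> closed S -> (forall Q, S Q -> frobenius_norm Q <= M) ->
  continuous f -> exists2 Q, S Q & forall Q', S Q' -> f Q <= f Q'.
Proof.
move=> S0 Scl Sb cf.
have imS : vec_mx @` (vec_mx @^-1` S) = S.
  apply/seteqP; split=> [_ [v Sv <-] //|Q SQ].
  by exists (mxvec Q); rewrite /= mxvecK.
have cS : compact S.
  rewrite -imS; apply: continuous_compact.
    by apply: continuous_subspaceT; exact: vec_mx_continuous.
  apply: bounded_closed_compact.
    exists M; split; first exact: num_real.
    move=> x Mx v /= Sv; rewrite [leLHS]/Num.norm /= mx_normrE.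
    have vb ij : `|v ij.1 ij.2| <= x.
      case: ij => i k /=; rewrite ord1; case/mxvec_indexP: k => k l.
      apply/ltW/(le_lt_trans _ Mx)/(le_trans _ (Sb _ Sv)).
      by rewrite (le_trans _ (ler_entry_frobenius _ k l)) // mxE.
    apply/bigmax_leP; split=> //.
    by rewrite ltW // (le_lt_trans _ Mx) // (le_trans _ (Sb _ Sv)) // frobenius_ge0.
  by apply: preimage_closed => // v _; exact: vec_mx_continuous.
have [Q] := compact_EVT_min S0 cS (continuous_subspaceT cf).
rewrite inE => SQ Qmin; exists Q => // Q' SQ'; apply: Qmin; exact/mem_set.
Qed.

End Compactness.

(** * Matrices supported on a set of positions *)

Section Restriction.
Variables (R : realType) (n : nat) (N : rel 'I_n).
Implicit Types X Y : 'M[R]_n.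

Definition restrict_mx X : 'M[R]_n := \matrix_(i, j) (if N i j then X i j else 0).

Lemma restrict_mxD X Y : restrict_mx (X + Y) = restrict_mx X + restrict_mx Y.
Proof. by apply/matrixP=> i j; rewrite !mxE; case: (N i j); rewrite ?addr0 //. Qed.

Lemma restrict_mxZ c X : restrict_mx (c *: X) = c *: restrict_mx X.
Proof. by apply/matrixP=> i j; rewrite !mxE; case: (N i j); rewrite ?mulr0 //. Qed.

Lemma restrict_mx_id X : restrict_mx (restrict_mx X) = restrict_mx X.
Proof. by apply/matrixP=> i j; rewrite !mxE; case: (N i j). Qed.

Lemma trmx_restrict X : symmetric N -> (restrict_mx X)^T = restrict_mx X^T.
Proof. by move=> Ns; apply/matrixP=> i j; rewrite !mxE Ns. Qed.

Lemma frobenius_restrict X : frobenius_norm (restrict_mx X) <= frobenius_norm X.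
Proof.
rewrite -ler_sqr ?nnegrE ?frobenius_ge0 // !frobenius_sqrE.
apply: ler_sum => i _; apply: ler_sum => j _; rewrite mxE.
by case: ifP => // _; rewrite expr0n sqr_ge0.
Qed.

Lemma mx_inner_restrict X Y :
  restrict_mx X = X -> mx_inner X (restrict_mx Y) = mx_inner X Y.
Proof.
move=> <-; rewrite !mx_innerE; apply: eq_bigr => i _; apply: eq_bigr => j _.
by rewrite !mxE; case: (N i j); rewrite ?mul0r.
Qed.

Lemma entrywise_continuous_restrict (F : 'M[R]_n -> 'M[R]_n) :
  entrywise_continuous F -> entrywise_continuous (fun Q => restrict_mx (F Q)).
Proof.
move=> cF i j.
rewrite (_ : (fun Q => _) = (fun Q => if N i j then F Q i j else 0)).
  by case: (N i j); [exact: cF|exact: cst_continuous].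
by apply/funext=> Q; rewrite mxE.
Qed.

End Restriction.

(** * The compressed commutator *)

Section CompressedCommutator.
Variables (R : realType) (n : nat).
Implicit Types A X : 'M[R]_n.
Local Notation H := (centering_mx R n).
Local Notation J := (const_mx 1 : 'M[R]_n).

Lemma trmx_centering : H^T = H.
Proof. by rewrite /centering_mx linearB linearZ /= trmx1 trmx_const. Qed.

Lemma centering_const : H *m J = 0.
Proof.
apply/matrixP=> i j; rewrite mulmxBl mul1mx -scalemxAl !mxE.
rewrite (eq_bigr (fun=> 1)) => [|k _]; last by rewrite !mxE mulr1.
rewrite sumr_const card_ord mulVf ?subrr // pnatr_eq0.
by case: (n) i => [[]|].
Qed.

Lemma centering_idem : H *m H = H.
Proof.
rewrite {2}/centering_mx mulmxBr mulmx1 -scalemxAr.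
by rewrite centering_const scaler0 subr0.
Qed.

(** The SSPWL of [A] is injectivity of this linear map of [X], on the symmetric
matrices vanishing on the diagonal and at the edges. On symmetric matrices it
takes skew values which kill the all-ones vector: they are the infinitesimal
generators of the rotations that fix that vector. *)
Definition compressed_commutator A X := H *m (A *m X - X *m A) *m H.

Lemma compressed_commutatorD A A' X :
  compressed_commutator (A + A') X =
  compressed_commutator A X + compressed_commutator A' X.
Proof.
rewrite /compressed_commutator -mulmxDl -mulmxDr; congr (_ *m _ *m _).
by rewrite mulmxDl mulmxDr opprD addrACA.
Qed.

Lemma compressed_commutatorZ A c X :
  compressed_commutator A (c *: X) = c *: compressed_commutator A X.
Proof.
by rewrite /compressed_commutator -scalemxAr -scalemxAl -scalerBr -scalemxAr -scalemxAl.
Qed.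

Lemma frobenius_compressed_commutator A X :
  frobenius_norm (compressed_commutator A X) <=
  2 * frobenius_norm H ^+ 2 * (frobenius_norm A * frobenius_norm X).
Proof.
apply: (le_trans (frobeniusM _ _)).
set h := frobenius_norm H; have h0 : 0 <= h by exact: frobenius_ge0.
have h1 : frobenius_norm (H *m (A *m X - X *m A)) <=
    h * (2 * (frobenius_norm A * frobenius_norm X)).
  apply: (le_trans (frobeniusM _ _)).
  by apply: ler_wpM2l => //; exact: frobenius_commutator.
have := ler_wpM2r h0 h1.
suff -> : 2 * h ^+ 2 * (frobenius_norm A * frobenius_norm X) =
  h * (2 * (frobenius_norm A * frobenius_norm X)) * h by [].
by ring.
Qed.

Lemma trmx_compressed_commutator A X : A^T = A -> X^T = X ->
  (compressed_commutator A X)^T = - compressed_commutator A X.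
Proof.
move=> As Xs; rewrite /compressed_commutator !trmx_mul trmx_centering mulmxA.
have -> : (A *m X - X *m A)^T = - (A *m X - X *m A).
  by rewrite [LHS]linearB /= !trmx_mul As Xs opprB.
by rewrite mulmxN mulNmx.
Qed.

Lemma compressed_commutator_const A X :
  compressed_commutator A X *m J = 0.
Proof. by rewrite -mulmxA centering_const mulmx0. Qed.

(** The map [X |-> compressed_commutator A X] is the adjoint of
[K |-> A K - K A], where [K] runs over the skew matrices killing the all-ones
vector; the identity is this duality at [K = compressed_commutator A X]. *)
Lemma mx_inner_compressed_commutator A X : A^T = A -> X^T = X ->
  let K := compressed_commutator A X in
  mx_inner X (A *m K - K *m A) = frobenius_norm K ^+ 2.
Proof.
move=> As Xs /=; set K := compressed_commutator A X.
have Ks : K^T = - K by exact: trmx_compressed_commutator.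
have KE : \tr (K *m K) = \tr ((A *m X - X *m A) *m K).
  rewrite /K /compressed_commutator; set C := A *m X - X *m A.
  rewrite -!mulmxA (mulmxA H H) centering_idem mxtrace_mulC -!mulmxA.
  by rewrite centering_idem.
clearbody K.
have YT : (A *m K - K *m A)^T = A *m K - K *m A.
  by rewrite [LHS]linearB /= !trmx_mul Ks As mulmxN mulNmx opprK addrC.
rewrite frobenius_sqr /mx_inner Ks YT mulNmx linearN /= KE.
rewrite !mulmxBl ![\tr (_ - _)]raddfB /= opprB; congr (_ - _).
  by rewrite mxtrace_mulC mulmxA.
by rewrite -mulmxA mxtrace_mulC.
Qed.

End CompressedCommutator.

(** * Isospectral matrices with prescribed entries *)

Section SpectralDescent.
Local Open Scope classical_set_scope.
Variables (R : realType) (n : nat) (N : rel 'I_n).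
Implicit Types A B T X : 'M[R]_n.
Local Notation J := (const_mx 1 : 'M[R]_n).

(** The constant is the minimum of the right-hand side over the unit sphere of
the space of symmetric matrices supported on [N]; homogeneity does the rest. *)
Lemma compressed_commutator_bounded_below A :
  (forall X, X^T = X -> restrict_mx N X = X ->
     compressed_commutator A X = 0 -> X = 0) ->
  exists2 sigma : R, 0 < sigma &
    forall X, X^T = X -> restrict_mx N X = X ->
      sigma * frobenius_norm X <= frobenius_norm (compressed_commutator A X).
Proof.
move=> inj.
pose S := [set X : 'M[R]_n | X^T = X] `&` [set X | restrict_mx N X = X] `&`
          [set X | frobenius_norm X = 1].
have scale X : X^T = X -> restrict_mx N X = X -> X != 0 ->
    S ((frobenius_norm X)^-1 *: X).
  move=> Xs XN X0; have x0 : frobenius_norm X != 0.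
    by apply: contra_neq X0; exact: frobenius_eq0.
  split; [split|] => /=; first by rewrite linearZ /= Xs.
    by rewrite restrict_mxZ XN.
  by rewrite frobeniusZ ger0_norm ?invr_ge0 ?frobenius_ge0 // mulVf.
have [S0|/nonemptyPn S0] := pselect (S !=set0); last first.
  (* An empty sphere means that 0 is the only symmetric matrix supported on [N],
     so any constant will do. *)
  exists 1 => // X Xs XN; have [->|X0] := eqVneq X 0.
    by rewrite frobenius0 mulr0 frobenius_ge0.
  by have := scale X Xs XN X0; rewrite S0.
have cid := @entrywise_continuous_id R n.
have ccst := @entrywise_continuous_cst R n.
have Scl : closed S.
  apply: closedI.
    apply: closedI; apply: closed_mx_eq => //.
      exact: entrywise_continuous_tr.
    exact: entrywise_continuous_restrict.
  apply: (preimage_closed _ (@closed_eq _ 1)) => X _.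
  exact: continuous_frobenius.
have cf : continuous (fun X => frobenius_norm (compressed_commutator A X)).
  apply: continuous_frobenius; do 2!apply: entrywise_continuousM => //.
  by apply: entrywise_continuousB; apply: entrywise_continuousM.
have Sb X : S X -> frobenius_norm X <= 1 by move=> [_ /= ->].
have [X0 [[X0s X0N] X01] X0min] := closed_bounded_argmin S0 Scl Sb cf.
exists (frobenius_norm (compressed_commutator A X0)).
  rewrite lt_neqAle frobenius_ge0 andbT eq_sym.
  apply/eqP=> /frobenius_eq0/(inj _ X0s X0N) X00.
  by move/eqP: X01; rewrite X00 frobenius0 eq_sym oner_eq0.
move=> X Xs XN; have [->|Xn0] := eqVneq X 0.
  by rewrite frobenius0 mulr0 frobenius_ge0.
have := X0min _ (scale X Xs XN Xn0).
have x0 : 0 < frobenius_norm X.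
  rewrite lt_neqAle frobenius_ge0 andbT eq_sym.
  by apply: contra_neq Xn0; exact: frobenius_eq0.
rewrite compressed_commutatorZ frobeniusZ ger0_norm ?invr_ge0 ?frobenius_ge0 //.
by rewrite mulrC ler_pdivlMr.
Qed.

(** The compressed commutator is bilinear and bounded, so moving [A] by a small
amount costs at most half of the constant valid at [A]. *)
Lemma compressed_commutator_bounded_below_near A :
  (forall X, X^T = X -> restrict_mx N X = X ->
     compressed_commutator A X = 0 -> X = 0) ->
  exists sigma r : R, [/\ 0 < sigma, 0 < r &
    forall B X, frobenius_norm (B - A) <= r ->
      X^T = X -> restrict_mx N X = X ->
      sigma * frobenius_norm X <= frobenius_norm (compressed_commutator B X)].
Proof.
move=> /compressed_commutator_bounded_below [sigma s0 low].
set h := frobenius_norm (centering_mx R n) ^+ 2.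
have h0 : 0 <= h by rewrite sqr_ge0.
exists (sigma / 2), (sigma / (4 * h + 1)); split.
- by rewrite divr_gt0.
- by rewrite divr_gt0 //; lra.
move=> B X; rewrite ler_pdivlMr; last by lra.
set d := frobenius_norm (B - A) => Br Xs XN.
have := low X Xs XN.
have -> : compressed_commutator A X =
    compressed_commutator B X - compressed_commutator (B - A) X.
  have := compressed_commutatorD A (B - A) X; rewrite [A + _]addrC subrK => ->.
  by rewrite addrK.
set x := frobenius_norm X => lowX.
have x0 : 0 <= x by exact: frobenius_ge0.
have := frobenius_compressed_commutator (B - A) X; rewrite -/h -/d -/x => up.
have := le_trans lowX (frobeniusB _ _).
have d0 : 0 <= d by exact: frobenius_ge0.
have dx0 : 0 <= d * x by rewrite mulr_ge0.
have := ler_wpM2r x0 Br; rewrite mulrDr mulr1 mulrDl.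
rewrite (_ : d * (4 * h) * x = 2 * (2 * h * (d * x))); last by ring.
by lra.
Qed.

(** If the entries on [N] miss their target by [X], conjugating by the Cayley
transform of [s K], with [K = compressed_commutator A X] and [s] small, moves
[A] by [- 2 s (A K - K A)] up to second order. The inner product of this
displacement with [X] is [- 2 s ||K||^2], so that [||X||^2] decreases by at
least [2 s ||K||^2] once [s] absorbs the second order terms. With
[||K|| >= sigma ||X||] this makes [||X||] decrease by at least [sigma eta],
where [eta = s ||K||] also measures how far [A] moves. *)
Lemma isospectral_descent A T (sigma : R) :
  symmetric N -> A^T = A -> T^T = T -> restrict_mx N T = T ->
  let X := restrict_mx N A - T in
  X != 0 -> 0 < sigma ->
  sigma * frobenius_norm X <= frobenius_norm (compressed_commutator A X) ->
  exists (U : 'M[R]_n) (eta : R),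
    [/\ 0 < eta, U^T *m U = 1%:M, U *m J = J,
        frobenius_norm (restrict_mx N (U^T *m A *m U) - T) <=
          frobenius_norm X - sigma * eta
      & frobenius_norm (U^T *m A *m U - A) <= 10 * frobenius_norm A * eta].
Proof.
move=> Ns As Ts TN X Xn0 s0 low.
have Xs : X^T = X by rewrite [LHS]linearB /= trmx_restrict // As Ts.
have XN : restrict_mx N X = X.
  rewrite /X -scaleN1r restrict_mxD restrict_mxZ TN.
  by rewrite restrict_mx_id.
have XE D : restrict_mx N (D + A) - T = X + restrict_mx N D.
  by rewrite restrict_mxD -addrA addrC.
clearbody X.
set K := compressed_commutator A X in low *.
have Ks : K^T = - K by exact: trmx_compressed_commutator.
have K1 : K *m J = 0 by exact: compressed_commutator_const.
have XY : mx_inner X (A *m K - K *m A) = frobenius_norm K ^+ 2.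
  exact: mx_inner_compressed_commutator.
clearbody K.
set a := frobenius_norm A; set x := frobenius_norm X in low *.
set k := frobenius_norm K in low XY *.
have a0 : 0 <= a by exact: frobenius_ge0.
have x0 : 0 < x.
  rewrite lt_neqAle frobenius_ge0 andbT eq_sym.
  by apply: contra_neq Xn0; exact: frobenius_eq0.
have k0 : 0 < k by apply: lt_le_trans low; rewrite mulr_gt0.
have xa0 : 0 <= x * a by rewrite mulr_ge0 // ltW.
have aa0 : 0 <= a ^+ 2 by exact: sqr_ge0.
(* The terms of [w] make [s = w^-1] satisfy [||s K|| <= 1] and bound the second
   order terms [60 x a (s k)^2] and [100 a^2 (s k)^2] of the squared norm,
   together, by [2 s k^2], half of the first order gain. *)
pose w := k + 30 * (x * a) + 50 * a ^+ 2.
have w0 : 0 < w by rewrite /w; lra.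
pose s := w^-1.
have sp : 0 < s by rewrite invr_gt0.
have sw : s * k + 30 * (s * (x * a)) + 50 * (s * a ^+ 2) = 1.
  rewrite -[RHS](_ : s * w = 1); last by rewrite mulVf // gt_eqF.
  by rewrite /w; ring.
have sk0 : 0 < s * k by rewrite mulr_gt0.
have sxa0 : 0 <= s * (x * a) by rewrite mulr_ge0 // ltW.
have saa0 : 0 <= s * a ^+ 2 by rewrite mulr_ge0 // ltW.
have Es : frobenius_norm (s *: K) = s * k by rewrite frobeniusZ gtr0_norm.
have sKs : (s *: K)^T = - (s *: K) by rewrite linearZ /= Ks scalerN.
have sK1 : (s *: K) *m J = 0.
  by rewrite -scalemxAl K1 scaler0.
have sK_le1 : frobenius_norm (s *: K) <= 1 by rewrite Es; lra.
have [U [UU U1]] := Cayley_perturbation As sKs sK1 sK_le1.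
set D := U^T *m A *m U - A; rewrite -/a Es => D1 D2.
exists U, (s * k); split=> //; last by rewrite -mulrA.
rewrite -(subrK A (U^T *m A *m U)) -/D XE.
set p := frobenius_norm (X + restrict_mx N D).
have XD : mx_inner X D <= x * (30 * (a * (s * k) ^+ 2)) - 2 * s * k ^+ 2.
  have -> : D = (D + 2 *: (A *m (s *: K) - (s *: K) *m A))
                + (- (2 * s)) *: (A *m K - K *m A).
    rewrite -scalemxAr -scalemxAl -scalerBr scalerA scaleNr -addrA subrr.
    by rewrite addr0.
  rewrite mx_innerDr mx_innerZr XY mulNr lerD2r.
  apply: (le_trans (mx_inner_Cauchy_Schwarz _ _)).
  by apply: ler_wpM2l => //; exact: ltW.
have RD : frobenius_norm (restrict_mx N D) ^+ 2 <= (10 * (a * (s * k))) ^+ 2.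
  rewrite ler_sqr ?nnegrE ?frobenius_ge0 //.
    exact: le_trans (frobenius_restrict _ _) D1.
  by rewrite mulr_ge0 // mulr_ge0 // ltW.
have pE : p ^+ 2 <= x ^+ 2 - 2 * (s * k ^+ 2).
  rewrite frobenius_sqr mx_innerDl !mx_innerDr -!frobenius_sqr.
  rewrite (mx_innerC (restrict_mx N D)) mx_inner_restrict // -/x.
  have sk2 : 0 <= s * k ^+ 2 by rewrite mulr_ge0 ?sqr_ge0 // ltW.
  have : s * k ^+ 2 * (30 * (s * (x * a)) + 50 * (s * a ^+ 2)) <= s * k ^+ 2.
    by rewrite ler_piMr //; lra.
  move: XD RD.
  by rewrite !exprMn; lra.
set q := sigma * (s * k).
have q0 : 0 <= q by rewrite mulr_ge0 // ltW.
have qx : q * x <= s * k ^+ 2.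
  have := ler_wpM2l (ltW sk0) low; rewrite /q.
  by rewrite (_ : s * k * k = s * k ^+ 2); [lra|ring].
have p0 : 0 <= p by exact: frobenius_ge0.
have xq : 0 <= x - q.
  have : 0 <= x * (x - 2 * q).
    have := sqr_ge0 p; rewrite mulrBr -expr2.
    by rewrite (_ : x * (2 * q) = 2 * (q * x)); [lra|ring].
  by rewrite pmulr_rge0 //; lra.
rewrite -ler_sqr ?nnegrE // sqrrB.
have q2 := sqr_ge0 q; rewrite -mulr_natl (mulrC x q); lra.
Qed.

(** This is local surjectivity at [A] of the restriction to [N], on the matrices
orthogonally similar to [A] through matrices fixing the all-ones vector. Here
[T] is reached by minimising [||restrict_mx N B - T|| + c ||B - A||] over these
conjugates [B]. The second term keeps the minimiser near [A], where the lower
bound [sigma] holds, and since [c * 10 ||A|| < sigma] a descent step would still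
decrease the sum if the first term were not zero. The norms must not be squared
here: near a zero of the first term, its square would decrease only
quadratically in [||K||], while the penalty may grow linearly. *)
Lemma isospectral_prescribed_entries A (delta : R) :
  symmetric N -> A^T = A ->
  (forall X, X^T = X -> restrict_mx N X = X ->
     compressed_commutator A X = 0 -> X = 0) ->
  0 < delta ->
  exists2 tau : R, 0 < tau & forall T,
    T^T = T -> restrict_mx N T = T ->
    frobenius_norm (restrict_mx N A - T) < tau ->
    exists Q : 'M[R]_n,
      [/\ Q^T *m Q = 1%:M, Q *m J = J,
          restrict_mx N (Q^T *m A *m Q) = T
        & frobenius_norm (Q^T *m A *m Q - A) < delta].
Proof.
move=> Ns As inj d0.
have [sigma [r [s0 r0 low]]] := compressed_commutator_bounded_below_near inj.
set a := frobenius_norm A; have a0 : 0 <= a by exact: frobenius_ge0.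
pose c := sigma / (10 * a + 1).
have c0 : 0 < c by rewrite divr_gt0 //; lra.
have ca : c * (10 * a) < sigma.
  rewrite /c mulrAC ltr_pdivrMr; last by lra.
  by rewrite ltr_pM2l //; lra.
exists (c * Num.min r delta); first by rewrite mulr_gt0 // lt_min r0.
move=> T Ts TN Tclose.
pose S := [set Q : 'M[R]_n | Q^T *m Q = 1%:M] `&`
          [set Q | Q *m J = J].
have S1 : S 1%:M by split => /=; rewrite ?trmx1 mul1mx.
have cid := @entrywise_continuous_id R n.
have ccst := @entrywise_continuous_cst R n.
have cconj : entrywise_continuous (fun Q : 'M[R]_n => Q^T *m A *m Q).
  apply: entrywise_continuousM => //; apply: entrywise_continuousM => //.
  exact: entrywise_continuous_tr.
have Scl : closed S.
  by apply: closedI; apply: closed_mx_eq => //; apply: entrywise_continuousM => //;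
     exact: entrywise_continuous_tr.
have Sb Q : S Q -> frobenius_norm Q <= frobenius_norm (1%:M : 'M[R]_n).
  by move=> [/= QQ _]; rewrite /frobenius_norm /mx_inner QQ trmx1 mulmx1.
pose g (Q : 'M[R]_n) := frobenius_norm (restrict_mx N (Q^T *m A *m Q) - T)
         + c * frobenius_norm (Q^T *m A *m Q - A).
have cg : continuous g.
  have c1 : continuous (fun Q : 'M[R]_n =>
      frobenius_norm (restrict_mx N (Q^T *m A *m Q) - T)).
    apply: continuous_frobenius; apply: entrywise_continuousB => //.
    exact: entrywise_continuous_restrict.
  have c2 : continuous (fun Q : 'M[R]_n => frobenius_norm (Q^T *m A *m Q - A)).
    by apply: continuous_frobenius; exact: entrywise_continuousB.
  move=> Q; exact: cvgD (c1 Q) (cvgM (cvg_cst c) (c2 Q)).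
have [|Q [/= QQ Q1] Qmin] := closed_bounded_argmin _ Scl Sb cg; first by exists 1%:M.
set B := Q^T *m A *m Q.
have Bs : B^T = B by rewrite /B !trmx_mul trmxK As mulmxA.
have Ba : frobenius_norm B = a by exact: frobenius_orth_conj.
have Bclose : frobenius_norm (B - A) < Num.min r delta.
  rewrite -(ltr_pM2l c0); apply: le_lt_trans Tclose.
  have := Qmin _ S1; rewrite /g -/B trmx1 mul1mx mulmx1 subrr frobenius0 mulr0.
  by have := frobenius_ge0 (restrict_mx N B - T); lra.
move: Bclose; rewrite lt_min => /andP[Br Bd].
exists Q; split=> //.
apply/eqP; rewrite -subr_eq0; apply/negPn/negP => Xn0.
have Xs : (restrict_mx N B - T)^T = restrict_mx N B - T.
  by rewrite [LHS]linearB /= trmx_restrict // Bs Ts.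
have XN : restrict_mx N (restrict_mx N B - T) = restrict_mx N B - T.
  by rewrite -scaleN1r restrict_mxD restrict_mxZ TN restrict_mx_id.
have [U [eta [e0 UU U1 gain cost]]] := isospectral_descent Ns Bs Ts TN Xn0 s0
  (low B _ (ltW Br) Xs XN).
have SQU : S (Q *m U).
  split=> /=; first by rewrite trmx_mul mulmxA -(mulmxA U^T) QQ mulmx1.
  by rewrite -mulmxA U1.
have := Qmin _ SQU.
have BU : (Q *m U)^T *m A *m (Q *m U) = U^T *m B *m U.
  by rewrite trmx_mul /B !mulmxA.
rewrite /g BU -/B leNgt => /negP; apply.
have : frobenius_norm (U^T *m B *m U - A) <=
    frobenius_norm (U^T *m B *m U - B) + frobenius_norm (B - A).
  by apply: le_trans (frobeniusD _ _); rewrite addrA subrK.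
rewrite -(ler_pM2l c0) mulrDr.
have := ler_wpM2l (ltW c0) cost; rewrite Ba mulrA.
have : c * (10 * a) * eta < sigma * eta by rewrite ltr_pM2r.
by move: gain; lra.
Qed.

End SpectralDescent.

(** * Weighted Laplacian matrices *)

Section WeightedLaplacian.
Variables (R : realType) (n : nat).
Implicit Types (G : sgraph n) (A B : 'M[R]_n).

Lemma graph_row_sum G B (i : 'I_n) :
  (forall j, i != j -> ~~ G i j -> B i j = 0) ->
  \sum_k B i k = B i i + \sum_(k | G k i) B i k.
Proof.
move=> B0; rewrite (bigD1 i) //=; congr (_ + _).
rewrite [LHS]big_mkcond [RHS]big_mkcond; apply: eq_bigr => k _.
have [->|ki] := eqVneq k i; first by rewrite adj_irrefl.
by rewrite adj_sym; case: ifPn => //; apply: B0; rewrite eq_sym.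
Qed.

Lemma edge_weights_bounded_away G A : weighted_laplacian G A ->
  exists2 eta : R, 0 < eta & forall i j, G i j -> eta <= - A i j.
Proof.
move=> [_ Aneg _ _].
exists (\big[Num.min/1]_(p : 'I_n * 'I_n | G p.1 p.2) - A p.1 p.2).
  apply/bigmin_gtP; split=> // -[i j] /= Gij; rewrite oppr_gt0 Aneg //.
  by apply: contraTneq Gij => ->; rewrite adj_irrefl.
by move=> i j Gij; exact: (@bigmin_le_cond _ _ _ _ (i, j)).
Qed.

Definition nonadjacent G : rel 'I_n := fun i j => (i != j) && ~~ G i j.

Lemma nonadjacent_sym G : symmetric (nonadjacent G).
Proof. by move=> i j; rewrite /nonadjacent eq_sym adj_sym. Qed.

(** The two entrywise conditions of the SSPWL confine [X] to the non-edges. Only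
the entries of [A] at the edges of [G] matter, so that [A] may be a Laplacian
matrix of a larger graph. *)
Lemma restrict_nonadjacent G A X :
  (forall i j, G i j -> A i j != 0) ->
  hadamard A X = 0 -> hadamard 1%:M X = 0 -> restrict_mx (nonadjacent G) X = X.
Proof.
move=> An0 /matrixP AX /matrixP IX; apply/matrixP=> i j; rewrite mxE.
case: ifPn => // /nandP[|] /negPn.
  move=> /eqP <-; have := IX i i.
  by rewrite !mxE eqxx mul1r.
move=> Gij; have /eqP := AX i j.
by rewrite !mxE mulf_eq0 (negPf (An0 _ _ Gij)) /= => /eqP.
Qed.

Lemma SSPWL_compressed_commutator G A X :
  weighted_laplacian G A -> SSPWL A ->
  X^T = X -> restrict_mx (nonadjacent G) X = X ->
  compressed_commutator A X = 0 -> X = 0.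
Proof.
move=> [_ _ A0 _] ssp Xs /matrixP XN KX0; apply: ssp => //.
  apply/matrixP=> i j; rewrite !mxE -(XN i j) mxE.
  by case: ifPn => [/andP[ij Gij]|_]; rewrite ?mulr0 // A0 // mul0r.
apply/matrixP=> i j; rewrite !mxE -(XN i j) mxE /nonadjacent.
by case: (i == j); rewrite /= ?mulr0 // mul0r.
Qed.

Lemma laplacian_mul_const G A :
  weighted_laplacian G A -> A *m (const_mx 1 : 'M[R]_n) = 0.
Proof.
move=> [_ _ A0 Ad]; apply/matrixP=> i j; rewrite !mxE.
under eq_bigr do rewrite mxE mulr1.
by rewrite (graph_row_sum (A0 i)) Ad addNr.
Qed.

End WeightedLaplacian.

Theorem lemma2p11 (R : realType) (n : nat) (G Gt : sgraph n) (A : 'M[R]_n)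
    (hGGt : spanning_subgraph G Gt)
    (hA : weighted_laplacian G A)
    (hSSP : SSPWL A) :
  forall delta : R, 0 < delta ->
    exists A' : 'M[R]_n,
      [/\ weighted_laplacian Gt A',
          spec A' =1 spec A,
          SSPWL A'
        & frobenius_norm (A' - A) < delta].
Proof.
move=> delta delta0.
pose N := nonadjacent G; have Ns : symmetric N := nonadjacent_sym G.
have inj X : X^T = X -> restrict_mx N X = X ->
    compressed_commutator A X = 0 -> X = 0.
  exact: SSPWL_compressed_commutator hA hSSP.
have [sigma [r [sigma0 r0 low]]] := compressed_commutator_bounded_below_near inj.
have [eta eta0 etaA] := edge_weights_bounded_away hA.
have [As _ A0 _] := hA.
pose d := Num.min delta (Num.min eta r).
have d0 : 0 < d by rewrite !lt_min delta0 eta0.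
have [tau tau0 attain] := isospectral_prescribed_entries Ns As inj d0.
(* The target prescribes [- eps] at the edges to be added, and 0 at the pairs
   that are non-adjacent in both graphs. *)
pose E : 'M[R]_n := \matrix_(i, j) (N i j && Gt i j)%:R.
pose eps := tau / (frobenius_norm E + 1).
have E0 : 0 < frobenius_norm E + 1 by have := frobenius_ge0 E; lra.
have eps0 : 0 < eps by rewrite divr_gt0.
pose T := - eps *: E.
have Ts : T^T = T.
  by apply/matrixP=> i j; rewrite !mxE Ns adj_sym.
have TN : restrict_mx N T = T.
  by apply/matrixP=> i j; rewrite !mxE; case: (N i j); rewrite ?mulr0.
have Tclose : frobenius_norm (restrict_mx N A - T) < tau.
  have -> : restrict_mx N A = 0.
    apply/matrixP=> i j; rewrite !mxE; case: ifPn => // /andP[ij Gij].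
    exact: A0.
  rewrite sub0r frobeniusN frobeniusZ normrN gtr0_norm // /eps mulrAC.
  by rewrite ltr_pdivrMr // ltr_pM2l // ltrDl.
have [Q [QQ QJ]] := attain T Ts TN Tclose.
set A' := Q^T *m A *m Q => A'T.
rewrite !lt_min => /and3P[A'delta A'eta A'r].
have A's : A'^T = A' by rewrite /A' !trmx_mul trmxK As mulmxA.
have A'N i j : N i j -> A' i j = - eps * (Gt i j)%:R.
  by move=> Nij; move/matrixP/(_ i j): A'T; rewrite !mxE Nij.
have A'G i j : G i j -> A' i j < 0.
  move=> Gij; have := etaA i j Gij.
  have := le_lt_trans (ler_entry_frobenius (A' - A) i j) A'eta.
  rewrite !mxE; set u := \sum_(_ < _) _.
  by have := ler_norm (u - A i j); lra.
have A'0 i j : i != j -> ~~ Gt i j -> A' i j = 0.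
  move=> ij Gtij; rewrite A'N ?(negPf Gtij) ?mulr0 // /N /nonadjacent ij.
  by apply: contra Gtij; exact: hGGt.
exists A'; split=> //.
- split=> // [i j ij Gtij|i].
    have [/A'G //|Gij] := boolP (G i j).
    by rewrite A'N /N /nonadjacent ?ij // Gtij mulr1 oppr_lt0.
  have := graph_row_sum (A'0 i).
  have A'J : A' *m (const_mx 1 : 'M[R]_n) = 0.
    by rewrite /A' -!mulmxA QJ (laplacian_mul_const hA) mulmx0.
  move/matrixP/(_ i i): A'J; rewrite mxE [RHS]mxE.
  under eq_bigr do rewrite [X in _ * X]mxE mulr1.
  by move=> -> /eqP; rewrite eq_sym addr_eq0 => /eqP.
- by move=> a; rewrite /spec char_poly_orth_conj.
- move=> X Xs AX IX KX0.
  have XN : restrict_mx N X = X.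
    by apply: restrict_nonadjacent AX IX => i j /A'G; rewrite lt_neqAle => /andP[].
  have := low A' X (ltW A'r) Xs XN.
  rewrite /compressed_commutator KX0 frobenius0 pmulr_rle0 // => X0.
  by apply/frobenius_eq0/eqP; rewrite eq_le X0 frobenius_ge0.
Qed.
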